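(* Let $n\ge 4$ and let $\mathcal{D}$ be a single-crossing domain of linear orders on an $n$-element set $A$ that is a maximal Condorcet domain. Then $\mathcal{D}$ is not single-peaked on a circle.
   Context: A domain $\mathcal{D}$ of linear orders on $A$ is single-crossing if its orders can be listed as $v_1,\ldots,v_m$ so that for every pair of alternatives $a,b$ the set of indices $i$ with $a\succ_{v_i}b$ is an initial or a final segment of $\{1,\ldots,m\}$. A Condorcet domain is a set $\mathcal{D}$ of linear orders on $A$ such that for every finite profile of voters with preferences from $\mathcal{D}$ the pairwise majority relation is acyclic; it is maximal if no Condorcet domain on $A$ properly contains it. A domain is single-peaked on a circle if the alternatives can be placed on a circle $a_1\triangleleft a_2\triangleleft\cdots\triangleleft a_n\triangleleft a_1$ so that for every order $v$ of the domain and every alternative $a$, the upper contour set $\{b\in A: b\succ_v a\}$ is a contiguous arc of the circle. *)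

(* Defs.v *)
From HB Require Import structures.
From mathcomp Require Import all_boot.

Set Implicit Arguments.
Unset Strict Implicit.
Unset Printing Implicit Defensive.

Section LinearOrders.
Variable A : finType.

(* Strict linear orders, stored as their graph so that they form a finType. *)
Definition is_linear_order (r : {set A * A}) : bool :=
  [&& [forall a, (a, a) \notin r],
      [forall a, forall b, forall c,
         ((a, b) \in r) && ((b, c) \in r) ==> ((a, c) \in r)]
    & [forall a, forall b, (a != b) ==> ((a, b) \in r) || ((b, a) \in r)]].

Record linear_order := LinearOrder {
  graph_of : {set A * A};
  _ : is_linear_order graph_of
}.

HB.instance Definition _ := [isSub for graph_of].
HB.instance Definition _ := [Finite of linear_order by <:].

Definition prefers (v : linear_order) (a b : A) : bool := (a, b) \in graph_of v.

Definition upper_contour (v : linear_order) (a : A) : {set A} :=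
  [set b | prefers v b a].

End LinearOrders.

Definition initial_segment (m : nat) (I : {set 'I_m}) : Prop :=
  forall i j : 'I_m, i <= j -> j \in I -> i \in I.

Definition final_segment (m : nat) (I : {set 'I_m}) : Prop :=
  forall i j : 'I_m, i <= j -> i \in I -> j \in I.

Section Domains.
Variable A : finType.
Implicit Types (D : {set linear_order A}) (P : seq (linear_order A)).

Definition single_crossing D : Prop :=
  exists (m : nat) (v : m.-tuple (linear_order A)),
    [/\ uniq v, v =i D
      & forall a b : A,
          let I := [set i : 'I_m | prefers (tnth v i) a b] in
          initial_segment I \/ final_segment I].

(* Strict majority: tied pairs are unrelated. *)
Definition majority P : rel A :=
  fun a b => count (fun v => prefers v b a) P < count (fun v => prefers v a b) P.

Definition acyclic (e : rel A) : Prop :=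
  forall c : seq A, c != [::] -> ~~ cycle e c.

(* A profile is a list, so several voters may share the same order. *)
Definition condorcet_domain D : Prop :=
  forall P, {subset P <= D} -> acyclic (majority P).

Definition maximal_condorcet_domain D : Prop :=
  condorcet_domain D /\
  forall D', D \proper D' -> ~ condorcet_domain D'.

(* [c] lists the points of the circle in cyclic order, cut at an arbitrary
   place; the arcs of length [l] are the prefixes of its rotations. *)
Definition circular_arc (c : seq A) (S : {set A}) : Prop :=
  exists i l : nat, S =i take l (rot i c).

Definition single_peaked_on_circle D : Prop :=
  exists c : seq A,
    [/\ uniq c, (forall a, a \in c)
      & forall v a, v \in D -> circular_arc c (upper_contour v a)].

End Domains.

(* Main.v *)
(* Fix the first order u of the single-crossing list. By maximality each order
   of the list arises from the previous one by swapping a single adjacent pair,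
   and every pair is eventually swapped exactly once. Two consecutive swaps
   cannot be disjoint, since performing the second one alone would give a new
   order that looks like a member of the domain on every triple. So consecutive
   swaps share an alternative, and either the same alternative takes part in all
   swaps, which is absurd, or some three swaps reverse a block of three adjacent
   alternatives. If upper contour sets are arcs, such a block has nothing above
   it (or, dually, nothing below it): an arc other than the empty set has only
   two one-point extensions. But after the reversal of an extreme block no
   further swap can share an alternative with the last one, although for n >= 4
   some pairs have not been swapped yet. *)

Require Import Defs.
From mathcomp Require Import all_boot.
From mathcomp Require Import perm.

Set Implicit Arguments.
Unset Strict Implicit.
Unset Printing Implicit Defensive.

Section Orders.
Variable A : finType.
Implicit Types (u v w : linear_order A) (a b c d x y z : A).

Lemma prefersxx v a : prefers v a a = false.
Proof. by case/and3P: (valP v) => /forallP/(_ a)/negbTE. Qed.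

Lemma prefers_trans v : transitive (prefers v).
Proof.
move=> b a c ab bc; case/and3P: (valP v) => _ /forallP/(_ a)/forallP/(_ b) h _.
by have /forallP/(_ c)/implyP := h; apply; apply/andP.
Qed.

Lemma prefersNV v a b : a != b -> prefers v b a = ~~ prefers v a b.
Proof.
move=> ab; case e: (prefers v a b) => /=.
  apply/negP=> ba; have := prefers_trans e ba; by rewrite prefersxx.
case/and3P: (valP v) => _ _ /forallP/(_ a)/forallP/(_ b)/implyP/(_ ab).
by rewrite -!/(prefers v _ _) e.
Qed.

Lemma prefers_neq v a b : prefers v a b -> a != b.
Proof. by apply: contraTneq => ->; rewrite prefersxx. Qed.

Lemma prefers_asym v a b : prefers v a b -> prefers v b a = false.
Proof. by move=> ab; rewrite prefersNV ?ab // (prefers_neq ab). Qed.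

Lemma order_of_rel (r : rel A) :
    irreflexive r -> transitive r -> (forall a b, a != b -> r a b || r b a) ->
  {v | prefers v =2 r}.
Proof.
move=> irr tr tot; pose g := [set p | r p.1 p.2].
have g_lin : is_linear_order g.
  apply/and3P; split.
  - by apply/forallP=> a; rewrite inE /= irr.
  - apply/forallP=> a; apply/forallP=> b; apply/forallP=> c.
    by apply/implyP; rewrite !inE /= => /andP[]; apply: tr.
  - apply/forallP=> a; apply/forallP=> b; apply/implyP; rewrite !inE; exact: tot.
by exists (LinearOrder g_lin) => a b; rewrite /prefers /= inE.
Qed.

Lemma linear_order_inhabited : exists v : linear_order A, true.
Proof.
have [||a b|v _] := @order_of_rel (fun a b => enum_rank a < enum_rank b).
- by move=> a; rewrite ltnn.
- by move=> b a c; apply: ltn_trans.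
- by move=> ab; rewrite -neq_ltn; apply: contraNneq ab => /ord_inj/enum_rank_inj ->.
by exists v.
Qed.

Fact reverse_subproof v : {w | forall a b, prefers w a b = prefers v b a}.
Proof.
apply: order_of_rel => [a|b a c|a b].
- exact: prefersxx.
- by move=> ba cb; apply: prefers_trans ba.
- by move=> ab; rewrite (prefersNV v ab) orNb.
Qed.

Definition reverse v := sval (reverse_subproof v).

Lemma reverseE v a b : prefers (reverse v) a b = prefers v b a.
Proof. exact: (svalP (reverse_subproof v)). Qed.

Lemma prefers_inj v w : prefers v =2 prefers w -> v = w.
Proof. by move=> e; apply/val_inj/setP => -[a b]; apply: e. Qed.

Lemma reverseK : involutive reverse.
Proof. by move=> v; apply: prefers_inj => a b; rewrite !reverseE. Qed.

Definition covers v a b := prefers v a b /\ forall c, ~~ (prefers v a c && prefers v c b).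

Lemma covers_injr v a b c : covers v a b -> covers v a c -> b = c.
Proof.
move=> [ab hb] [ac hc]; apply/eqP/negPn/negP => bc.
move: (hb c) (hc b); rewrite ab ac /= => /negbTE cb.
by rewrite (prefersNV v) ?cb // eq_sym.
Qed.

Lemma covers_injl v a b c : covers v a c -> covers v b c -> a = b.
Proof.
move=> [ac ha] [bc hb]; apply/eqP/negPn/negP => ab.
move: (ha b) (hb a); rewrite ac bc !andbT => /negbTE e.
by rewrite (prefersNV v) ?e.
Qed.

Definition adjacent_swap v a b w :=
  [/\ prefers v a b, prefers w b a
    & forall x y, ~~ ((x \in pred2 a b) && (y \in pred2 a b)) ->
        prefers w x y = prefers v x y].

Section Swap.
Variables (v w : linear_order A) (a b : A).

Lemma adjacent_swap_sym : adjacent_swap v a b w -> adjacent_swap w b a v.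
Proof.
case=> ab ba e; split=> // x y; rewrite !inE ![(_ == b) || _]orbC => h.
by rewrite e // !inE.
Qed.

Lemma swapEl x y : adjacent_swap v a b w -> x != a -> x != b ->
  prefers w x y = prefers v x y.
Proof. by case=> _ _ e /negbTE xa /negbTE xb; apply: e; rewrite !inE xa xb. Qed.

Lemma swapEr x y : adjacent_swap v a b w -> y != a -> y != b ->
  prefers w x y = prefers v x y.
Proof. by case=> _ _ e /negbTE xa /negbTE xb; apply: e; rewrite !inE xa xb andbF. Qed.

Lemma swap_away x y : adjacent_swap v a b w -> x != a -> y != a ->
  prefers w x y = prefers v x y.
Proof.
move=> s xa ya; have [xb|xb] := eqVneq x b; last exact: swapEl s xa xb.
have [yb|yb] := eqVneq y b; last exact: swapEr s ya yb.
by rewrite xb yb !prefersxx.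
Qed.

Lemma swap_covers : adjacent_swap v a b w -> covers v a b.
Proof.
move=> s; have [ab ba _] := s; split=> // c; apply/negP=> /andP[ac cb].
have ca : c != a by rewrite eq_sym (prefers_neq ac).
have /prefers_neq cb' := cb.
have: prefers w a b by apply: (@prefers_trans w c); rewrite ?(swapEr _ s ca cb') ?(swapEl _ s ca cb').
by rewrite (prefers_asym ba).
Qed.

End Swap.

Lemma covers_swap v a b : covers v a b -> exists w, adjacent_swap v a b w.
Proof.
move=> [ab nb]; pose t := tperm a b.
have [||x y|w we] := @order_of_rel (fun x y => prefers v (t x) (t y)).
- by move=> x; apply: prefersxx.
- by move=> y x z; apply: prefers_trans.
- by move=> xy; rewrite [X in _ || X](prefersNV v) ?orbN // (inj_eq perm_inj).
have abE c : c != a -> c != b -> (prefers v a c = prefers v b c) * (prefers v c a = prefers v c b).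
  move=> ca cb; move: (nb c); rewrite !(prefersNV v ca) !(prefersNV v cb).
  case e1: (prefers v c a); case e2: (prefers v c b) => //= _.
  by rewrite (prefers_trans e1 ab) in e2.
exists w; split=> //; first by rewrite we /t tpermL tpermR.
move=> x y; rewrite we !inE /t.
case: tpermP => [->|->|/eqP xa /eqP xb]; rewrite ?eqxx ?orbT ?(negbTE xa) ?(negbTE xb) /=.
- rewrite negb_or => /andP[ya yb]; rewrite tpermD 1?eq_sym //.
  by rewrite abE.
- rewrite negb_or => /andP[ya yb]; rewrite tpermD 1?eq_sym //.
  by rewrite abE.
- by move=> _; case: tpermP => [->|->|//]; rewrite ?abE.
Qed.

Lemma swap_covers_left v a b w c :
  adjacent_swap v a b w -> covers v c a -> covers w c b.
Proof.
move=> s [ca nca]; have [ab ba _] := s; have [_ nab] := swap_covers s.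
have cb := prefers_trans ca ab; have n1 := prefers_neq ca; have n2 := prefers_neq cb.
split=> [|x]; first by rewrite (swapEl _ s).
apply/negP=> /andP[]; rewrite (swapEl _ s) // => cx xb.
have xa : x != a by apply: contraTneq xb => ->; rewrite (prefers_asym ba).
have xb' := prefers_neq xb; rewrite (swapEl _ s) // in xb.
move: (nca x) (nab x); rewrite cx xb andbT /= => /negbTE e.
by rewrite (prefersNV v) ?e.
Qed.

Lemma reverse_swap v a b w :
  adjacent_swap v a b w -> adjacent_swap (reverse v) b a (reverse w).
Proof.
case=> ab ba e; split; rewrite ?reverseE // => x y h.
rewrite !reverseE e //; move: h; rewrite !inE andbC.
by rewrite ![(_ == b) || _]orbC.
Qed.

Lemma reverse_covers v a b : covers v a b -> covers (reverse v) b a.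
Proof. by case=> ab h; split=> [|c]; rewrite !reverseE // andbC. Qed.

Lemma swap_covers_right v a b w c :
  adjacent_swap v a b w -> covers v b c -> covers w a c.
Proof.
move=> /reverse_swap s /reverse_covers /(swap_covers_left s)/reverse_covers.
by rewrite reverseK.
Qed.

Lemma covers_upper v a b : covers v a b -> upper_contour v b = a |: upper_contour v a.
Proof.
move=> [ab nab]; apply/setP=> x; rewrite !inE; have [->//|xa /=] := eqVneq x a.
apply/idP/idP => [xb|xa']; last exact: prefers_trans ab.
by move: (nab x); rewrite xb andbT => /negbTE e; rewrite (prefersNV v) ?e // eq_sym.
Qed.

Lemma swap_upper v a b w : adjacent_swap v a b w -> upper_contour w b = upper_contour v a.
Proof.
move=> s; have [ab ba _] := s; have [_ nab] := swap_covers s.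
apply/setP=> x; rewrite !inE.
have [->|xa] := eqVneq x a; first by rewrite prefersxx (prefers_asym ba).
have [->|xb] := eqVneq x b; first by rewrite prefersxx (prefers_asym ab).
rewrite (swapEl _ s) //; apply/idP/idP => [h|h]; last exact: prefers_trans ab.
by move: (nab x); rewrite h andbT => /negbTE e; rewrite (prefersNV v) ?e // eq_sym.
Qed.

Lemma swap_upper_out v a b w x : adjacent_swap v a b w -> x != a -> x != b ->
  upper_contour w x = upper_contour v x.
Proof. by move=> s xa xb; apply/setP=> y; rewrite !inE (swapEr _ s). Qed.

End Orders.

Section CondorcetDomains.
Variable A : finType.
Implicit Types (u v w : linear_order A) (a b c d x y z : A).
Implicit Types (D : {set linear_order A}) (P : seq (linear_order A)).

Lemma count_prefersC P a b : a != b ->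
  count (fun v => prefers v a b) P + count (fun v => prefers v b a) P = size P.
Proof.
move=> ab; rewrite -(count_predC (fun v => prefers v a b) P); congr (_ + _).
by apply: eq_count => v /=; apply: prefersNV.
Qed.

Lemma tournament_acyclic (e : rel A) :
    irreflexive e -> (forall a b, e a b -> ~~ e b a) ->
    (forall a b, a != b -> e a b || e b a) ->
    (forall a b c, e a b -> e b c -> e c a -> False) ->
  acyclic e.
Proof.
move=> irr asym tot no3 [//|x p] _; apply/negP=> /= px.
have tr : transitive e.
  move=> b a c ab bc; have [eac|ac] := eqVneq a c.
    by move: (asym _ _ ab); rewrite eac bc.
  by case/orP: (tot _ _ ac) => // /(no3 _ _ _ ab bc).
have /allP/(_ x) := order_path_min tr px.
by rewrite mem_rcons mem_head irr => /(_ isT).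
Qed.

(* In a profile with an even number of voters every strict majority has margin
   at least 2, so duplicating one voter preserves it and makes the majority
   relation a tournament. *)
Lemma condorcet_no_3cycle D :
    (forall P, {subset P <= D} -> forall a b c,
       majority P a b -> majority P b c -> majority P c a -> False) ->
  condorcet_domain D.
Proof.
move=> no3 P PD.
case: P PD => [|v P] PD; first by case=> [|x [|y c]].
suff [Q [QD oddQ sPQ]] : exists Q, [/\ {subset Q <= D}, odd (size Q)
    & subrel (majority (v :: P)) (majority Q)].
  have acyc : acyclic (majority Q).
    apply: tournament_acyclic (no3 Q QD) => [a|a b|a b ab].
    - by rewrite /majority ltnn.
    - by rewrite /majority -leqNgt => /ltnW.
    - rewrite /majority -neq_ltn; apply: contraTneq oddQ => e.
      by rewrite -(count_prefersC Q ab) e addnn odd_double.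
  move=> c c0; apply: contra (acyc c c0).
  by case: c {c0} => [//|x p] /=; apply: sub_path.
case odd_P: (odd (size (v :: P))); first by exists (v :: P); split.
exists [:: v, v & P]; split; last first.
- move=> a b; have [->|ab] := eqVneq a b; first by rewrite /majority ltnn.
  set Q := v :: P; have countE p : count p (v :: Q) = p v + count p Q by [].
  rewrite /majority !countE; have := count_prefersC Q ab.
  set k := count (fun w => prefers w b a) Q; set l := count _ Q => s.
  rewrite (prefersNV v ab); case: (prefers v a b) => /=.
    by rewrite add0n add1n => /leqW.
  move=> kl; have: odd (l + k) = false by rewrite s.
  rewrite add1n add0n ltn_neqAle kl andbT oddD => par; apply: contraFneq par => <-.
  by rewrite /= addNb addbb.
- by rewrite /= negbK -[odd _]negbK -[~~ odd _]/(odd (size (v :: P))) odd_P.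
- by move=> w; rewrite inE => /orP[/eqP->|/PD //]; apply: PD; rewrite mem_head.
Qed.

(* Along a single-crossing list starting at [u] these sets decrease, so
   [nested u D] expresses single-crossingness without an explicit listing. *)
Definition agreement u v := graph_of u :&: graph_of v.

Lemma in_agreement u v a b : ((a, b) \in agreement u v) = prefers u a b && prefers v a b.
Proof. by rewrite inE. Qed.

Definition nested u D := {in D &, forall v w,
  agreement u v \subset agreement u w \/ agreement u w \subset agreement u v}.

Lemma nested_pair u D a b c d : nested u D -> prefers u a b = prefers u c d ->
    a != b -> c != d ->
  {in D, forall v, prefers v a b -> prefers v c d} \/
  {in D, forall v, prefers v c d -> prefers v a b}.
Proof.
wlog uab : a b c d / prefers u a b => [IH|] nestD uu ab cd.
  case uab: (prefers u a b); first exact: IH.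
  have [//|||||h|h] := IH b a d c; rewrite 1?eq_sym // ?(prefersNV u ab) ?uab //.
  - by rewrite (prefersNV u cd) -uu uab.
  - right=> v vD; apply: contraTT => nab; rewrite -(prefersNV v cd); apply: h => //.
    by rewrite (prefersNV v ab).
  - left=> v vD; apply: contraTT => nab; rewrite -(prefersNV v ab); apply: h => //.
    by rewrite (prefersNV v cd).
case: (boolP [forall v in D, prefers v a b ==> prefers v c d]) => [/forall_inP h|].
  by left=> v /h/implyP.
case/forall_inPn=> v vD; rewrite negb_imply => /andP[vab vcd].
right=> w wD wcd; case: (nestD v w vD wD) => /subsetP s.
  by have := s (a, b); rewrite !in_agreement uab vab => /(_ isT).
by have := s (c, d); rewrite !in_agreement -uu uab wcd (negbTE vcd) => /(_ isT).
Qed.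

(* The voters with [a] over [b] and those with [b] over [c] form comparable
   sets; the smaller one is disjoint from the voters with [c] over [a]. *)
Lemma nested_no_3cycle u D P a b c : nested u D -> {subset P <= D} ->
    prefers u a b = prefers u b c ->
  majority P a b -> majority P b c -> majority P c a -> False.
Proof.
move=> nestD PD uu mab mbc mca.
have neq x y : majority P x y -> x != y by apply: contraTneq => ->; rewrite /majority ltnn.
have [nab nbc nca] := And3 (neq _ _ mab) (neq _ _ mbc) (neq _ _ mca).
have cnt (p q : pred (linear_order A)) :
    {in D, forall v, p v -> q v} -> count p P <= count q P.
  move=> pq; rewrite (@eq_in_count _ p [predI p & q]) => [|v /PD vD /=].
    by apply: sub_count => v /andP[].
  by apply/idP/andP=> [pv|[]//]; split=> //; apply: pq.
rewrite /majority in mab mbc mca.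
case: (nested_pair nestD uu nab nbc) => h.
  have ab_ac := cnt (fun v => prefers v a b) (fun v => prefers v a c)
    (fun v vD ab => prefers_trans ab (h v vD ab)).
  have ca_ba : count (fun v => prefers v c a) P <= count (fun v => prefers v b a) P.
    apply: cnt => v vD ca; rewrite (prefersNV v nab); apply: contraTN ca => ab.
    by rewrite (prefers_asym (prefers_trans ab (h v vD ab))).
  move: (leq_trans mab ab_ac) (leq_trans mca ca_ba) => h1 h2.
  by have := ltn_trans h1 h2; rewrite ltnn.
have bc_ac := cnt (fun v => prefers v b c) (fun v => prefers v a c)
  (fun v vD bc => prefers_trans (h v vD bc) bc).
have ca_cb : count (fun v => prefers v c a) P <= count (fun v => prefers v c b) P.
  apply: cnt => v vD ca; rewrite (prefersNV v nbc); apply: contraTN ca => bc.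
  by rewrite (prefers_asym (prefers_trans (h v vD bc) bc)).
move: (leq_trans mbc bc_ac) (leq_trans mca ca_cb) => h1 h2.
by have := ltn_trans h1 h2; rewrite ltnn.
Qed.

Lemma nested_condorcet u D : nested u D -> condorcet_domain D.
Proof.
move=> nestD; apply: condorcet_no_3cycle => P PD a b c ab bc ca.
have no3 := nested_no_3cycle nestD PD.
case: (eqVneq (prefers u a b) (prefers u b c)) => [e|n1]; first exact: (no3 _ _ _ e).
case: (eqVneq (prefers u b c) (prefers u c a)) => [e|n2]; first exact: (no3 _ _ _ e).
apply: (no3 c a b) => //; move: n1 n2.
by case: (prefers u a b); case: (prefers u b c); case: (prefers u c a).
Qed.

Lemma condorcet_triplewise D D' : condorcet_domain D ->
    {in D', forall w a b c, exists2 v, v \in D &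
      {in [:: a; b; c] &, prefers w =2 prefers v}} ->
  condorcet_domain D'.
Proof.
move=> condD loc; apply: condorcet_no_3cycle => P PD' a b c ab bc ca.
have [Q QD e] : exists2 Q, {subset Q <= D} & {in [:: a; b; c] &, forall x y,
    count (fun v => prefers v x y) P = count (fun v => prefers v x y) Q}.
  elim: P PD' {ab bc ca} => [|w P IH] PD'; first by exists [::].
  have [|Q QD e] := IH; first by move=> v vP; apply: PD'; rewrite inE vP orbT.
  have [v vD ev] := loc w (PD' w (mem_head _ _)) a b c.
  exists (v :: Q) => [x|x y xs ys /=]; last by rewrite ev ?e.
  by rewrite inE => /orP[/eqP->|/QD].
have /negP[] : ~~ cycle (majority Q) [:: a; b; c] by apply: condD.
by rewrite /= /majority -!e ?inE ?eqxx ?orbT // andbT; apply/and3P.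
Qed.

Lemma single_crossing_nested D : maximal_condorcet_domain D -> single_crossing D ->
  exists2 u, u \in D & nested u D.
Proof.
case=> _ maxD [[|m] [v [_ vD cross]]].
  have [w _] := linear_order_inhabited A.
  case: (maxD [set w]); last first.
    apply: (@nested_condorcet w) => x y; rewrite !inE => /eqP-> /eqP->.
    by left.
  have D0 (r : linear_order A) : r \in D = false by rewrite -vD [v]tuple0.
  apply/properP; split; first by apply/subsetP=> x; rewrite D0.
  by exists w; rewrite ?set11 ?D0.
exists (tnth v ord0); first by rewrite -vD mem_tnth.
have mono (i j : 'I_m.+1) : i <= j ->
    agreement (tnth v ord0) (tnth v j) \subset agreement (tnth v ord0) (tnth v i).
  move=> ij; apply/subsetP => -[a b]; rewrite !in_agreement => /andP[ab jab].
  rewrite ab /=; have := cross a b; rewrite /=; case=> seg.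
    by have := seg i j ij; rewrite !inE; apply.
  by have := seg ord0 i (leq0n _); rewrite !inE; apply.
move=> x y; rewrite -!vD => /tnthP[i ->] /tnthP[j ->].
by case: (leqP i j) => [|/ltnW] ij; [right|left]; apply: mono.
Qed.

Section MaximalChain.
Variables (u : linear_order A) (D : {set linear_order A}).
Hypotheses (maxD : maximal_condorcet_domain D) (nestD : nested u D).

Lemma maximal_mem_condorcet w : condorcet_domain (w |: D) -> w \in D.
Proof.
case: maxD => _ mx cw; case: (boolP (w \in D)) => // wD.
by case: (mx (w |: D)) => //; apply: properUr; rewrite sub1set.
Qed.

Lemma maximal_mem w : {in D, forall v,
    agreement u v \subset agreement u w \/ agreement u w \subset agreement u v} ->
  w \in D.
Proof.
move=> cmp; apply: maximal_mem_condorcet; apply: (@nested_condorcet u).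
move=> x y /setU1P[->|xD] /setU1P[->|yD]; [by left| |exact: cmp|exact: nestD].
by have [|] := cmp y yD; [right|left].
Qed.

(* Let [w] be the member of [D] next after [v]. A pair on which they differ with
   fewest alternatives between in [v] is adjacent in [v], and swapping it gives
   an order lying between [v] and [w]. *)
Lemma next_swap v a b : v \in D -> prefers u a b -> prefers v a b ->
  exists c d w, [/\ prefers u c d, adjacent_swap v c d w & w \in D].
Proof.
move=> vD uab vab.
have rD : reverse u \in D.
  apply: maximal_mem => x _; right; apply/subsetP=> -[x1 x2].
  rewrite !in_agreement reverseE => /andP[e1 e2].
  by rewrite (prefers_asym e1) in e2.
pose S := [pred w | (w \in D) && (agreement u w \proper agreement u v)].
have Sr : S (reverse u).
  rewrite /S /= rD properE /=; apply/andP; split.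
    apply/subsetP=> -[x1 x2]; rewrite !in_agreement reverseE => /andP[e1 e2].
    by rewrite (prefers_asym e1) in e2.
  apply/subsetPn; exists (a, b); rewrite !in_agreement ?uab //.
  by rewrite reverseE (prefers_asym uab).
case: (arg_maxnP (fun w => #|agreement u w|) Sr) => w /andP[wD].
rewrite properE => /andP[wv /subsetPn[[c0 d0]]] + + wmax.
rewrite !in_agreement => /andP[ucd vcd]; rewrite ucd /= => wcd.
pose gap (p : A * A) := #|[set c | prefers v p.1 c && prefers v c p.2]|.
pose Q := [pred p | (p \in agreement u v) && (p \notin agreement u w)].
have Qcd : Q (c0, d0) by rewrite /Q /= !in_agreement ucd vcd.
case: (arg_minnP gap Qcd) => -[c d] /andP[]; rewrite !in_agreement.
move=> {c0 d0 ucd vcd wcd Qcd} /andP[ucd vcd]; rewrite ucd /= => wcd gap_min.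
have nextcd : covers v c d.
  have min_gap x y : prefers v x y -> ~~ prefers w x y -> ~~ (
      [set z | prefers v x z && prefers v z y] \proper
      [set z | prefers v c z && prefers v z d]).
    move=> vxy wxy; apply/negP => /proper_card; rewrite ltnNge => /negP[].
    apply: (gap_min (x, y)); rewrite /Q /= !in_agreement vxy (negbTE wxy) !andbF !andbT.
    have nyx : y != x by rewrite eq_sym (prefers_neq vxy).
    rewrite (prefersNV u nyx); apply/negP=> uyx.
    move/subsetP: wv => /(_ (y, x)); rewrite !in_agreement uyx (prefersNV w) ?wxy.
      by rewrite (prefers_asym vxy) => /(_ isT).
    by rewrite eq_sym.
  split=> // e; apply/negP=> /andP[ce ed].
  case wce: (prefers w c e).
    have wed : ~~ prefers w e d by apply: contra wcd; apply: prefers_trans.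
    case/negP: (min_gap e d ed wed); apply/properP; split.
      apply/subsetP=> z; rewrite !inE => /andP[ez ->]; rewrite andbT.
      exact: prefers_trans ez.
    by exists e; rewrite !inE ?ce ?prefersxx.
  case/negP: (min_gap c e ce (negbT wce)); apply/properP; split.
    apply/subsetP=> z; rewrite !inE => /andP[-> ze] /=.
    exact: prefers_trans ed.
  by exists e; rewrite !inE ?ce ?prefersxx ?andbF.
have [x sx] := covers_swap nextcd; have [_ xdc ex] := sx.
exists c, d, x; split=> //; apply: maximal_mem => y yD.
have agrx : agreement u x = agreement u v :\ (c, d).
  apply/setP=> -[p q]; rewrite in_setD1 !in_agreement xpair_eqE.
  case: (boolP ((p \in pred2 c d) && (q \in pred2 c d))) => [|h]; last first.
    rewrite ex //; case: eqP h => // ->; case: eqP => // ->.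
    by rewrite !inE !eqxx orbT.
  rewrite !inE => /andP[/orP[]/eqP-> /orP[]/eqP->]; rewrite ?prefersxx ?andbF ?eqxx //=.
    by rewrite (prefers_asym xdc) andbF.
  by rewrite (prefers_asym ucd) andbF.
have wx : agreement u w \subset agreement u x.
  by rewrite agrx subsetD1 wv in_agreement (negbTE wcd) andbF.
have xv : agreement u x \subset agreement u v by rewrite agrx subD1set.
have [yv|vy] := nestD yD vD; last by right; apply: subset_trans vy.
have [/eqP yveq|ynv] := boolP (agreement u y == agreement u v); first by right; rewrite yveq.
left; apply: subset_trans wx; have [//|wy] := nestD yD wD.
have Sy : S y by rewrite /S /= yD properEneq ynv.
have /eqP <- : agreement u w == agreement u y by rewrite eqEcard wy; apply: wmax.
exact: subxx.
Qed.

(* Otherwise swapping [c] and [d] in [v] gives an order that agrees with [v] or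
   [r] on every triple, hence lies in [D], but is incomparable to [w]. *)
Lemma concatenation v w r a b c d : v \in D -> w \in D -> r \in D ->
    prefers u a b -> prefers u c d -> adjacent_swap v a b w -> adjacent_swap w c d r ->
  ~~ uniq [:: a; b; c; d].
Proof.
move=> vD wD rD uab ucd s1 s2; apply/negP=> abcd.
have [] : [/\ c != a, c != b, d != a & d != b].
  move: abcd; rewrite /= !inE !negb_or ![c == _]eq_sym ![d == _]eq_sym.
  by case/and4P=> /and3P[_ -> ->] /andP[-> ->].
move=> ca cb da db.
have [wcd rdc er] := s2; have [vab wba ew] := s1.
have [t st] : exists t, adjacent_swap v c d t.
  apply: covers_swap; have [_ nxt] := swap_covers s2.
  split=> [|e]; first by rewrite -(swapEl _ s1).
  by rewrite -(swapEl _ s1) // -(swapEr _ s1).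
have [vcd tdc et] := st.
have both_in (s : seq A) p q e f : p \in s -> q \in s -> p != q ->
    (p \in pred2 e f) && (q \in pred2 e f) -> (e \in s) && (f \in s).
  move=> ps qs npq /andP[/pred2P pE /pred2P qE]; move: ps qs npq.
  by case: pE qE => -> [] ->; rewrite ?eqxx // => -> ->.
have tD : t \in D.
  apply: maximal_mem_condorcet; apply: (@condorcet_triplewise D); first by case: maxD.
  move=> z /setU1P[->|zD] p q s; last by exists z.
  have [cd_in|] := boolP ((c \in [:: p; q; s]) && (d \in [:: p; q; s])); last first.
    move=> ncd; exists v => // p' q' p'_in q'_in.
    have [->|npq] := eqVneq p' q'; first by rewrite !prefersxx.
    by apply: et; apply: contra ncd; apply: both_in.
  have nab : ~~ ((a \in [:: p; q; s]) && (b \in [:: p; q; s])).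
    apply/negP=> ab_in; suff: size [:: a; b; c; d] <= size [:: p; q; s] by [].
    apply: (uniq_leq_size abcd) => e; move: cd_in ab_in => /andP[c_in d_in] /andP[a_in b_in].
    by rewrite [e \in _]inE => /predU1P[->//|]; rewrite 3!inE => /or3P[]/eqP->.
  exists r => // p' q' p'_in q'_in.
  have [->|npq] := eqVneq p' q'; first by rewrite !prefersxx.
  have [|h] := boolP ((p' \in pred2 c d) && (q' \in pred2 c d)); last first.
    by rewrite et // er // ew //; apply: contra nab; apply: both_in.
  case/andP=> /pred2P[]-> /pred2P[]->; rewrite ?prefersxx //.
    by rewrite (prefers_asym tdc) (prefers_asym rdc).
  by rewrite tdc rdc.
have tab : prefers t a b by rewrite (swapEl _ st) // eq_sym.
case: (nestD wD tD) => /subsetP.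
  by move/(_ (c, d)); rewrite !in_agreement ucd wcd (prefers_asym tdc) => /(_ isT).
by move/(_ (a, b)); rewrite !in_agreement uab tab (prefers_asym wba) => /(_ isT).
Qed.

End MaximalChain.

End CondorcetDomains.

Section Arcs.
Variables (A : finType) (c : seq A).
Hypotheses (c_uniq : uniq c) (c_full : forall a, a \in c).
Implicit Types (S T : {set A}) (x y z : A).

Lemma arc0 : circular_arc c set0.
Proof. by exists 0, 0 => x; rewrite take0 !inE. Qed.

Lemma arcC S : circular_arc c S -> circular_arc c (~: S).
Proof.
case=> i [l S_il]; wlog le_i : i S_il / i <= size c.
  move=> IH; case: (leqP i (size c)) => [|/ltnW/rot_oversize ei]; first exact: IH.
  by apply: (IH 0) => //; rewrite rot0 -ei.
wlog le_l : l S_il / l <= size c.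
  move=> IH; case: (leqP l (size c)) => [|/ltnW ll]; first exact: IH.
  by apply: (IH (size c)) => // x; rewrite S_il !take_oversize ?size_rot.
have d_uniq : uniq (rot i c) by rewrite rot_uniq.
exists (if l + i <= size c then l + i else l + i - size c), (size (drop l (rot i c))) => x.
rewrite -rot_add_mod // [rot l _]/(drop l _ ++ _) take_size_cat // inE S_il.
move: d_uniq (c_full x); rewrite -(mem_rot i) -{1 2}(cat_take_drop l (rot i c)).
rewrite cat_uniq mem_cat => /and3P[_ /hasPn disj _].
case: (boolP (x \in drop l _)) => [/disj/negbTE-> //|_]; by rewrite orbF => ->.
Qed.

Lemma arc_exit_unique S x y : circular_arc c S -> x \in S -> y \in S ->
  next c x \notin S -> next c y \notin S -> x = y.
Proof.
case=> i [l S_il]; set d := rot i c in S_il.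
have d_uniq : uniq d by rewrite rot_uniq.
have d_full z : z \in d by rewrite mem_rot.
suff idx z : z \in S -> next c z \notin S -> index z d = l.-1.
  move=> xS yS nx ny; rewrite -(nth_index x (d_full x)) -[RHS](nth_index x (d_full y)).
  by rewrite !idx.
rewrite !S_il -(next_rot i c_uniq) -/d !in_take // => zl.
rewrite -leqNgt => nl.
have ld : index z d < size d by rewrite index_mem.
have dz : index (next d z) d = if (index z d).+1 < size d then (index z d).+1 else 0.
  rewrite next_nth d_full; move: d_uniq ld (d_full z).
  case: d {S_il d_full zl nl} => [//|e d] de_uniq ld zd.
  case: ifP => h; first by rewrite -[nth _ _ _]/(nth e (e :: d) (index z (e :: d)).+1) index_uniq.
  rewrite nth_default /= ?eqxx //.
  by rewrite leqNgt -ltnS h.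
case: ifP dz nl => [_ ->|_ ->].
  by move=> h; apply/eqP; rewrite -eqSS prednK ?(leq_ltn_trans _ zl) // eqn_leq zl.
by rewrite leqn0 => /eqP l0; rewrite l0 in zl.
Qed.

Lemma next_closed T t x : t \in T -> {in T, forall s, next c s \in T} -> x \in T.
Proof.
move=> tT clT; have : fconnect (next c) t x.
  by rewrite (fconnect_cycle (cycle_next c_uniq)).
move=> /iter_findex <-; elim: (findex _ _ _) => //= k; exact: clT.
Qed.

(* An arc can only be extended by a single point at its two ends. *)
Lemma arc_extensions T x y z : circular_arc c T -> T != set0 ->
    x \notin T -> y \notin T -> z \notin T ->
    circular_arc c (x |: T) -> circular_arc c (y |: T) -> circular_arc c (z |: T) ->
  ~~ uniq [:: x; y; z].
Proof.
move=> arcT /set0Pn[t tT] xT yT zT arcx arcy arcz.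
have /existsP[s /andP[sT sexit]] : [exists s, (s \in T) && (next c s \notin T)].
  apply: contraNT xT => /existsPn h; apply: (next_closed _ tT) => s sT.
  by have := h s; rewrite sT negbK.
have entry e : e \notin T -> circular_arc c (e |: T) -> e != next c s -> next c e \in T.
  move=> eT arce nes.
  have : next c e \in e |: T.
    apply: contraNT eT => ne; suff -> : e = s by [].
    apply: (arc_exit_unique arce) => //; rewrite ?inE ?eqxx ?sT ?orbT //.
    by rewrite negb_or eq_sym nes.
  rewrite inE => /orP[|//]; rewrite inE => /eqP ee.
  have : t \in [set e] by apply: (@next_closed _ e); rewrite ?inE // => r; rewrite inE => /eqP->; rewrite ee inE.
  by rewrite inE => /eqP te; rewrite -te tT in eT.
have same e f : e \notin T -> f \notin T -> circular_arc c (e |: T) -> circular_arc c (f |: T) ->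
    e != next c s -> f != next c s -> e = f.
  move=> eT fT arce arcf ne nf.
  by apply: (arc_exit_unique (arcC arcT)); rewrite !inE ?negbK //; apply: entry.
rewrite /= !inE; apply/negP => /andP[/norP[xy xz] /andP[yz _]].
have [xs|xs] := eqVneq x (next c s); last have [ys|ys] := eqVneq y (next c s).
- by case/eqP: yz; apply: same; rewrite // -xs eq_sym.
- by case/eqP: xz; apply: same; rewrite // -ys eq_sym.
- by case/eqP: xy; apply: same.
Qed.

Section Contours.
Variable v : linear_order A.
Definition lower_contour x := [set y | prefers v x y].
Hypothesis arc_upper : forall x, circular_arc c (upper_contour v x).

Lemma arc_lower x : circular_arc c (lower_contour x).
Proof.
have [->|/set0Pn[y0]] := eqVneq (lower_contour x) set0; first exact: arc0.
rewrite inE => xy0.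
case: (arg_minnP (fun y => #|upper_contour v y|) xy0) => y xy ymin.
have cov : covers v x y.
  split=> // z; apply/negP=> /andP[xz zy]; have := ymin z xz; apply/negP.
  rewrite -ltnNge; apply/proper_card/properP; split.
    by apply/subsetP=> e; rewrite !inE => ez; apply: prefers_trans zy.
  by exists z; rewrite inE ?prefersxx.
suff -> : lower_contour x = ~: upper_contour v y by apply/arcC/arc_upper.
rewrite (covers_upper cov); apply/setP=> z; rewrite !inE negb_or.
have [->|zx] := eqVneq z x; first by rewrite prefersxx.
by rewrite -(prefersNV v zx).
Qed.

End Contours.
End Arcs.

Section SwapChains.
Variable A : finType.
Implicit Types (u v w r : linear_order A) (a b c d x y z : A).
Implicit Types (D : {set linear_order A}).

Record swap_chain u D : Prop := SwapChain {
  chain_next : forall v a b, v \in D -> prefers u a b -> prefers v a b ->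
    exists c d w, [/\ prefers u c d, adjacent_swap v c d w & w \in D];
  chain_concat : forall v w r a b c d, v \in D -> w \in D -> r \in D ->
    prefers u a b -> prefers u c d -> adjacent_swap v a b w ->
    adjacent_swap w c d r -> ~~ uniq [:: a; b; c; d] }.

Lemma swap_chain_reverse u D :
  swap_chain u D -> swap_chain (reverse u) [set v | reverse v \in D].
Proof.
case=> next concat; split=> [v a b|v w r a b c d]; rewrite !inE !reverseE.
  move=> vD uba vab; have [|c [d [w [ucd s wD]]]] := next _ _ _ vD uba.
    by rewrite reverseE.
  exists d, c, (reverse w); rewrite inE reverseK reverseE; split=> //.
  by rewrite -[v]reverseK; apply: reverse_swap.
move=> vD wD rD uba udc /reverse_swap s1 /reverse_swap s2.
apply: contra (concat _ _ _ _ _ _ _ vD wD rD uba udc s1 s2).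
have -> : [:: b; a; d; c] = rev [:: c; d; a; b] by [].
by rewrite rev_uniq (uniq_catC [:: c; d] [:: a; b]).
Qed.

Lemma consecutive_swaps u D v w r a b c d : swap_chain u D ->
    v \in D -> w \in D -> r \in D -> prefers u a b -> prefers u c d ->
    adjacent_swap v a b w -> adjacent_swap w c d r ->
  [/\ c = a, d != a & d != b] \/ [/\ d = b, c != a & c != b].
Proof.
case=> _ concat vD wD rD uab ucd s1 s2.
have [_ wba _] := s1; have [wcd _ _] := s2.
have cov_ba := swap_covers (adjacent_swap_sym s1); have cov_cd := swap_covers s2.
have not_ba : ~ (c = b /\ d = a).
  by case=> cb da; move: ucd; rewrite cb da (prefers_asym uab).
have cb : c != b.
  apply/eqP=> cb; apply: not_ba; split=> //; rewrite cb in cov_cd.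
  exact: (covers_injr cov_cd cov_ba).
have da : d != a.
  apply/eqP=> da; apply: not_ba; split=> //; rewrite da in cov_cd.
  exact: (covers_injl cov_cd cov_ba).
have [ca|nca] := eqVneq c a.
  left; split=> //; apply: contraTneq wcd => ->.
  by rewrite ca (prefers_asym wba).
have [db|ndb] := eqVneq d b.
  by right.
have := concat _ _ _ _ _ _ _ vD wD rD uab ucd s1 s2.
rewrite /= !inE !negb_or (prefers_neq uab) (prefers_neq ucd) (eq_sym a) nca.
by rewrite (eq_sym a) da (eq_sym b) cb (eq_sym b) ndb.
Qed.

Section Descent.
Variables (c : seq A) (u : linear_order A) (D : {set linear_order A}).
Hypotheses (c_uniq : uniq c) (c_full : forall a, a \in c) (card_ge4 : 4 <= #|A|).
Hypothesis chain : swap_chain u D.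
Hypothesis arc_upper : forall v x, v \in D -> circular_arc c (upper_contour v x).

(* Reversing a block a > b > d by the swaps ab, ad, bd makes T + a, T + b and
   T + d upper contours, where T is the set above the block; hence T is empty.
   Then no swap compatible with the next one required below d > b > a exists. *)
Lemma no_block_reversal v0 v1 v2 v3 a b d : v0 \in D -> v1 \in D -> v2 \in D -> v3 \in D ->
    prefers u a b -> prefers u a d -> prefers u b d ->
    adjacent_swap v0 a b v1 -> adjacent_swap v1 a d v2 -> adjacent_swap v2 b d v3 ->
    (forall x y, x != a -> y != a -> prefers v2 x y = prefers u x y) ->
  False.
Proof.
move=> v0D v1D v2D v3D uab uad ubd s1 s2 s3 v2u.
have [nab nad nbd] := And3 (prefers_neq uab) (prefers_neq uad) (prefers_neq ubd).
set T := upper_contour v0 a.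
have T1 : upper_contour v1 b = T by apply: swap_upper s1.
have T2 : upper_contour v2 b = T by rewrite (swap_upper_out s2) // eq_sym.
have T3 : upper_contour v3 d = T by rewrite (swap_upper s3).
have arcT : circular_arc c T by apply: arc_upper.
have Ta : upper_contour v0 b = a |: T by rewrite (covers_upper (swap_covers s1)).
have Tb : upper_contour v1 a = b |: T.
  by rewrite (covers_upper (swap_covers (adjacent_swap_sym s1))) T1.
have Td : upper_contour v3 b = d |: T.
  by rewrite (covers_upper (swap_covers (adjacent_swap_sym s3))) T3.
have [T0|Tn0] := eqVneq T set0; last first.
  have : ~~ uniq [:: a; b; d].
    apply: (arc_extensions c_uniq c_full arcT Tn0).
    - by rewrite inE prefersxx.
    - by rewrite -T1 inE prefersxx.
    - by rewrite -T3 inE prefersxx.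
    - by rewrite -Ta; apply: arc_upper.
    - by rewrite -Tb; apply: arc_upper.
    - by rewrite -Td; apply: arc_upper.
  by rewrite /= !inE negb_or nab nad nbd.
have [z zabd] : exists z, z \notin [:: a; b; d].
  apply/existsP; apply: contraTT card_ge4 => /existsPn h; rewrite -ltnNge ltnS.
  rewrite -[#|A|]cardsT (leq_trans _ (card_size [:: a; b; d])) //.
  by apply/subset_leq_card/subsetP => z _; have := h z; rewrite negbK.
move: zabd; rewrite !inE !negb_or => /and3P[za zb zd].
have v3bz : prefers v3 b z.
  rewrite (prefersNV v3 zb); apply/negP => h.
  have : z \in upper_contour v3 b by rewrite inE.
  by rewrite Td T0 !inE orbF (negbTE zd).
have ubz : prefers u b z by rewrite -v2u -?(swapEr _ s3) // eq_sym.
have [e [f [v4 [uef s4 v4D]]]] := chain_next chain v3D ubz v3bz.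
have [[eb fb fd]|[fd eb ed]] := consecutive_swaps chain v2D v3D v4D ubd uef s3 s4.
  have cov_ba : covers v3 b a.
    by apply: (swap_covers_right s3); apply: swap_covers (adjacent_swap_sym s2).
  move: (swap_covers s4); rewrite eb => /covers_injr/(_ cov_ba) fa.
  by move: uef; rewrite eb fa (prefers_asym uab).
have [v3ef _ _] := s4.
have : e \in upper_contour v3 d by rewrite inE -fd.
by rewrite T3 T0 inE.
Qed.

Lemma no_descent v0 v1 v2 a b d : v0 \in D -> v1 \in D -> v2 \in D ->
    prefers u a b -> prefers u a d ->
    adjacent_swap v0 a b v1 -> adjacent_swap v1 a d v2 ->
    (forall x y, x != a -> y != a -> prefers v2 x y = prefers u x y) ->
  False.
Proof.
have [n] := ubnP #|lower_contour v2 a|; elim: n v0 v1 v2 b d => // n IH v0 v1 v2 b d.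
move=> le_n v0D v1D v2D uab uad s1 s2 v2u.
have [nab nad] := (prefers_neq uab, prefers_neq uad).
have v2bd : prefers v2 b d.
  have [[_ v1ba _] [v1ad _ _]] := (s1, s2).
  rewrite (swapEl _ s2) 1?eq_sym //; first exact: prefers_trans v1ad.
  by apply: contraTneq v1ad => ->; rewrite (prefers_asym v1ba).
have cov_bd : covers v2 b d.
  by apply: (swap_covers_left s2); apply: swap_covers (adjacent_swap_sym s1).
have ubd : prefers u b d by rewrite -v2u // eq_sym.
have [e [f [v3 [uef s3 v3D]]]] := chain_next chain v2D ubd v2bd.
have [[ea fa fd]|[fd ea ed]] := consecutive_swaps chain v1D v2D v3D uad uef s2 s3.
  rewrite {}ea in uef s3.
  apply: (IH v1 v2 v3 d f) => // [|x y xa ya]; last by rewrite (swap_away s3) ?v2u.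
  rewrite -ltnS (leq_trans _ le_n) // ltnS; apply/proper_card/properP.
  have [v2af v3fa _] := s3; split; last first.
    by exists f; rewrite inE ?v2af // (prefers_asym v3fa).
  apply/subsetP=> x; rewrite !inE => v3ax.
  have xf : x != f by apply: contraTneq v3ax => ->; rewrite (prefers_asym v3fa).
  by rewrite -(swapEr _ s3) // eq_sym (prefers_neq v3ax).
rewrite {}fd in uef s3.
have eb : e = b by apply: covers_injl cov_bd; apply: swap_covers s3.
rewrite {}eb in uef s3.
exact: (no_block_reversal v0D v1D v2D v3D uab uad ubd s1 s2 s3).
Qed.

End Descent.
End SwapChains.

Theorem theorem4 (n : nat) (A : finType) (D : {set linear_order A})
    (n_ge4 : 4 <= n) (cardA : #|A| = n)
    (D_single_crossing : single_crossing D)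
    (D_maximal : maximal_condorcet_domain D) :
  ~ single_peaked_on_circle D.
Proof.
move=> [c [c_uniq c_full arcs]]; rewrite -{}cardA in n_ge4.
have [u uD nestD] := single_crossing_nested D_maximal D_single_crossing.
have chain : swap_chain u D.
  split; [exact: next_swap D_maximal nestD | exact: concatenation D_maximal nestD].
have /card_gt1P[x0 [y0 [_ _ xy]]] : 1 < #|A| by apply: leq_trans n_ge4.
have [a0 [b0 ab0]] : exists a b, prefers u a b.
  case e: (prefers u x0 y0); first by exists x0, y0.
  by exists y0, x0; rewrite (prefersNV u xy) e.
have [a [b [v1 [uab s1 v1D]]]] := chain_next chain uD ab0 ab0.
have [z zab] : exists z, z \notin [:: a; b].
  apply/existsP; apply: contraTT n_ge4 => /existsPn h; rewrite -ltnNge !ltnS.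
  rewrite -[#|A|]cardsT (leq_trans _ (leqW (card_size [:: a; b]))) //.
  by apply/subset_leq_card/subsetP => z _; have := h z; rewrite negbK.
move: zab; rewrite !inE negb_or => /andP[za zb].
have [p [q [upq v1pq]]] : exists p q, prefers u p q /\ prefers v1 p q.
  case e: (prefers u a z); first by exists a, z; rewrite (swapEr _ s1).
  by exists z, a; rewrite (swapEl _ s1) // (prefersNV u (a := a)) 1?eq_sym // e.
have [d [e [v2 [ude s2 v2D]]]] := chain_next chain v1D upq v1pq.
have [[da ea eb]|[eb da db]] := consecutive_swaps chain uD v1D v2D uab ude s1 s2.
  rewrite {}da in ude s2.
  have v2u x y : x != a -> y != a -> prefers v2 x y = prefers u x y.
    by move=> xa ya; rewrite (swap_away s2) // (swap_away s1).
  exact: (no_descent c_uniq c_full n_ge4 chain arcs uD v1D v2D uab ude s1 s2 v2u).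
rewrite {}eb in ude s2.
move: uab ude; rewrite -!(reverseE u) => uba ubd.
have [r1 r2] := (reverse_swap s1, reverse_swap s2).
have v2u x y : x != b -> y != b -> prefers (reverse v2) x y = prefers (reverse u) x y.
  by move=> xb yb; rewrite (swap_away r2) // (swap_away r1).
have rD v : v \in D -> reverse v \in [set w | reverse w \in D].
  by rewrite inE reverseK.
have rarcs v x : v \in [set w | reverse w \in D] -> circular_arc c (upper_contour v x).
  rewrite inE => vD.
  have -> : upper_contour v x = lower_contour (reverse v) x.
    by apply/setP=> y; rewrite !inE reverseE.
  by apply: arc_lower => // y; apply: arcs.
exact: (no_descent c_uniq c_full n_ge4 (swap_chain_reverse chain) rarcs
  (rD u uD) (rD v1 v1D) (rD v2 v2D) uba ubd r1 r2 v2u).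
Qed.
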